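(* If $\Gamma$ and $\Delta$ are connected quasi-isometric graphs, then \[\mathsf{wCop}(\Delta)=\mathsf{wCop}(\Gamma)\quad\text{and}\quad\mathsf{sCop}(\Delta)=\mathsf{sCop}(\Gamma).\]
   Context: Graphs are undirected, without double edges and without loops. For a connected graph $\Gamma$, $\mathsf{dist}$ (or $\mathsf{dist}_\Gamma$) is the path distance on $V(\Gamma)$. Quasi-retractions and quasi-isometry. For metric spaces $X,Y$ and constants $C\ge1$, $D\ge0$, a function $f\colon X\to Y$ is $(C,D)$-Lipschitz if $\mathsf{dist}_Y(f(x_1),f(x_2))\le C\,\mathsf{dist}_X(x_1,x_2)+D$ for all $x_1,x_2\in X$. A quasi-retraction of $Y$ to $X$ is a pair $(f,g)$ of $(C,D)$-Lipschitz functions $f\colon X\to Y$, $g\colon Y\to X$, for some constants $C\ge1$, $D\ge0$, with $\mathsf{dist}_X(g(f(x)),x)\le D$ for all $x\in X$. For connected graphs these notions are applied to vertex sets with path distances. Connected graphs $\Gamma$ and $\Delta$ are quasi-isometric if there are maps $f\colon V(\Delta)\to V(\Gamma)$ and $g\colon V(\Gamma)\to V(\Delta)$ such that $(f,g)$ is a quasi-retraction from $\Gamma$ to $\Delta$ and $(g,f)$ is a quasi-retraction from $\Delta$ to $\Gamma$. Game. The cops and robber game on a connected graph $\Gamma$ has parameters: number of cops $n$, cop speed $\sigma$, cop reach $\rho$, robber speed $\psi$, a vertex $v$, and a positive integer $R$. It is a perfect information game. First the $n$ cops choose initial vertices $c^1_0,\dots,c^n_0$; then, knowing these, the robber chooses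 an initial vertex $r_0$. In stage $k\ge 1$ each cop moves from $c^i_{k-1}$ to a vertex $c^i_k$ with $\mathsf{dist}(c^i_{k-1},c^i_k)\le\sigma$. The robber is captured during stage $k$ if $\mathsf{dist}(r_{k-1},c^i_k)\le\rho$ for some $i$. If not captured, the robber moves from $r_{k-1}$ to a vertex $r_k$ such that there is a path from $r_{k-1}$ to $r_k$ of length at most $\psi$ all of whose vertices are at distance larger than $\rho$ from every $c^i_k$. The cops win (protect the $R$-ball centered at $v$) if the robber is captured at some stage or there is $N>0$ such that $\mathsf{dist}(v,r_k)>R$ for all $k\ge N$. $\Gamma$ is $\mathsf{CopWin}(n,\sigma,\rho,\psi,R)$ if for every vertex $v$ of $\Gamma$ the $n$ cops have a winning strategy in the game with parameters $n,\sigma,\rho,\psi,v,R$. $\Gamma$ is $n$-weak cop win if $\exists\,\sigma\in\mathbb{Z}_{>0}\ \exists\,\rho\in\mathbb{Z}_{\ge0}\ \forall\,\psi,R\in\mathbb{Z}_{>0}$: $\Gamma$ is $\mathsf{CopWin}(n,\sigma,\rho,\psi,R)$. $\Gamma$ is $n$-strong cop win if $\exists\,\sigma\in\mathbb{Z}_{>0}\ \forall\,\psi\in\mathbb{Z}_{>0}\ \exists\,\rho\in\mathbb{Z}_{\ge0}\ \forall\,R\in\mathbb{Z}_{>0}$: $\Gamma$ is $\mathsf{CopWin}(n,\sigma,\rho,\psi,R)$. The weak cop number $\mathsf{wCop}(\Gamma)$ (resp. strong cop number $\mathsf{sCop}(\Gamma)$) in $\mathbb{Z}_{>0}\cup\{\infty\}$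 is the smallest positive integer $n$ such that $\Gamma$ is $n$-weak (resp. $n$-strong) cop win, and $\infty$ if there is none. *)

(* Defs.v *)
From mathcomp Require Import all_boot all_order all_algebra.
From mathcomp Require Import boolp reals.

Set Implicit Arguments.
Unset Strict Implicit.
Unset Printing Implicit Defensive.

Record graph := Graph {
  vertex :> Type;
  adj : rel vertex;
  adj_sym : symmetric adj;
  adj_irr : irreflexive adj }.

Definition connected (G : graph) : Prop :=
  forall x y : G, exists p : seq G, path (@adj G) x p /\ last x p = y.

Definition path_of_length (G : graph) (x y : G) : pred nat :=
  fun m => `[< exists p : seq G,
                 [/\ path (@adj G) x p, last x p = y & size p = m] >].

(* The value 0 for vertices in different components is a junk value; dist is
   only meant for connected graphs. *)
Definition dist (G : graph) (x y : G) : nat :=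
  if pselect (exists m, path_of_length x y m) is left ex then ex_minn ex else 0.

Section QuasiRetraction.
Local Open Scope ring_scope.
Variables (R : realType) (X Y : Type) (dX : X -> X -> R) (dY : Y -> Y -> R).

Definition coarse_lipschitz (C D : R) (f : X -> Y) : Prop :=
  forall x1 x2, dY (f x1) (f x2) <= C * dX x1 x2 + D.

End QuasiRetraction.

(* (f, g) is a quasi-retraction of Y, the codomain of f, to X. *)
Definition quasi_retraction (R : realType) (X Y : Type)
    (dX : X -> X -> R) (dY : Y -> Y -> R) (f : X -> Y) (g : Y -> X) : Prop :=
  (exists C D : R,
    [/\ 1 <= C, 0 <= D, coarse_lipschitz dX dY C D f,
        coarse_lipschitz dY dX C D g & forall x, dX (g (f x)) x <= D])%R.

Definition gdist (R : realType) (G : graph) (x y : G) : R := ((dist x y)%:R)%R.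

Definition quasi_isometric (R : realType) (G D : graph) : Prop :=
  exists (f : D -> G) (g : G -> D),
    quasi_retraction (@gdist R D) (@gdist R G) f g /\
    quasi_retraction (@gdist R G) (@gdist R D) g f.

Section Game.
Variables (G : graph) (n sigma rho psi : nat).

Definition cops := 'I_n -> G.

Definition captured (c : cops) (r : G) : bool :=
  [exists i, dist r (c i) <= rho].

Definition robber_move (c : cops) (r r' : G) : Prop :=
  exists p : seq G,
    [/\ path (@adj G) r p, last r p = r', size p <= psi &
        all (fun x => [forall i, rho < dist x (c i)]) (r :: p)].

(* The argument lists the past positions (c_0, r_0), ..., (c_(k-1), r_(k-1))
   and the value is c_k; the value at [::] is the initial placement. *)
Definition cop_strategy := seq (cops * G) -> cops.

Definition legal_strategy (S : cop_strategy) : Prop :=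
  forall h c r i, dist (c i) (S (rcons h (c, r)) i) <= sigma.

Definition follows (S : cop_strategy) (c : nat -> cops) (r : nat -> G) : Prop :=
  forall k, c k = S (mkseq (fun j => (c j, r j)) k).

(* Stage k.+1. The robber is free after a capture, when the cops have already
   won; without a capture staying put is a legal move, so every play that stops
   at a capture is a prefix of such an infinite sequence. *)
Definition robber_plays_legally (c : nat -> cops) (r : nat -> G) : Prop :=
  forall k, ~~ captured (c k.+1) (r k) -> robber_move (c k.+1) (r k) (r k.+1).

Definition cops_win (v : G) (R : nat) (c : nat -> cops) (r : nat -> G) : Prop :=
  (exists k, captured (c k.+1) (r k)) \/
  (exists N, 0 < N /\ forall k, N <= k -> R < dist v (r k)).

Definition winning_strategy (v : G) (R : nat) (S : cop_strategy) : Prop :=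
  legal_strategy S /\
  forall c r, follows S c r -> robber_plays_legally c r -> cops_win v R c r.

Definition CopWin (R : nat) : Prop :=
  forall v : G, exists S : cop_strategy, winning_strategy v R S.

End Game.

Definition weak_cop_win (G : graph) (n : nat) : Prop :=
  exists sigma, 0 < sigma /\ exists rho, forall psi R, 0 < psi -> 0 < R ->
    CopWin G n sigma rho psi R.

Definition strong_cop_win (G : graph) (n : nat) : Prop :=
  exists sigma, 0 < sigma /\ forall psi, 0 < psi -> exists rho,
    forall R, 0 < R -> CopWin G n sigma rho psi R.

(* None stands for infinity. *)
Definition least_positive (P : nat -> Prop) : option nat :=
  if pselect (exists m, `[< 0 < m /\ P m >]) is left ex
  then Some (ex_minn ex) else None.

Definition wCop (G : graph) : option nat := least_positive (weak_cop_win G).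
Definition sCop (G : graph) : option nat := least_positive (strong_cop_win G).

(* Main.v *)
Require Import Defs.
From mathcomp Require Import all_boot all_order all_algebra.
From mathcomp Require Import boolp reals.

(** Both cop numbers are monotone under quasi-retractions, and a quasi-isometry
    is a pair of quasi-retractions, one in each direction.

    Let [f : H -> G] and [g : G -> H] be coarsely Lipschitz with [g \o f] close
    to the identity, and suppose that the cops win on [G].  To play on [H], the
    cops imagine a shadow game on [G]: whenever the real robber is at [r], the
    shadow robber is at [f r]; the shadow cops follow their winning strategy on
    [G], and the real cops stand at the images under [g] of the shadow cops.
    Three facts make this work.
    - A real robber who keeps far away from the real cops has a shadow that can
      legally follow it: the image under [f] of an edge is replaced by a
      geodesic of bounded length, and a shadow cop close to that geodesic would
      produce a real cop close to the edge ([robber_move_shadow]).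
    - A captured shadow means that the real robber is captured with the larger
      reach ([near_shadow]).
    - A shadow far from [f v] means that the real robber is far from [v], since
      [f] is coarsely Lipschitz.

    The new speed of the cops depends on the old speed only, the new reach on
    the old reach only, and the robber's speed and the radius used on [G] are
    functions of those wanted on [H] ([CopWin_retract]).  This is compatible
    with the order of the quantifiers of both notions of cop win. *)

Set Implicit Arguments.
Unset Strict Implicit.
Unset Printing Implicit Defensive.

Import Order.TTheory GRing.Theory Num.Theory.

(** * The path distance *)

Lemma dist_le_size (G : graph) (x : G) (p : seq G) :
  path (@adj G) x p -> dist x (last x p) <= size p.
Proof.
move=> xp; rewrite /dist; case: pselect => // ex.
by case: ex_minnP => m _; apply; apply/asboolP; exists p.
Qed.

Lemma geodesic_exists (G : graph) (x y : G) : connected G ->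
  exists p, [/\ path (@adj G) x p, last x p = y & size p = dist x y].
Proof.
move=> conG; rewrite /dist; case: pselect => [ex|nex].
  by case: ex_minnP => m /asboolP.
have [p [xp lp]] := conG x y.
by case: nex; exists (size p); apply/asboolP; exists p.
Qed.

Lemma dist_refl (G : graph) (x : G) : dist x x = 0.
Proof. by apply/eqP; rewrite -leqn0; exact: (@dist_le_size G x [::]). Qed.

Lemma dist_adj (G : graph) (x y : G) : adj x y -> dist x y <= 1.
Proof. by move=> xy; apply: (@dist_le_size G x [:: y]); rewrite /= xy. Qed.

Lemma dist_triangle (G : graph) (x y z : G) : connected G ->
  dist x z <= dist x y + dist y z.
Proof.
move=> conG.
have [p [xp lp <-]] := geodesic_exists x y conG.
have [q [yq lq <-]] := geodesic_exists y z conG.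
have <- : last x (p ++ q) = z by rewrite last_cat lp.
by rewrite -size_cat; apply: dist_le_size; rewrite cat_path xp lp.
Qed.

Lemma dist_le_sym (G : graph) (x y : G) : connected G -> dist y x <= dist x y.
Proof.
move=> conG; have [p [xp lp <-]] := geodesic_exists x y conG.
have <- : last y (rev (belast x p)) = x.
  by case: p lp {xp} => [<-|z p _] //=; rewrite rev_cons last_rcons.
rewrite -(size_belast x p) -size_rev; apply: dist_le_size.
rewrite -lp rev_path; apply: sub_path xp => a b.
by rewrite adj_sym.
Qed.

Lemma dist_sym (G : graph) (x y : G) : connected G -> dist x y = dist y x.
Proof. by move=> conG; apply/eqP; rewrite eqn_leq !dist_le_sym. Qed.

(** * Quasi-retractions with integral constants *)

Definition nat_lipschitz (K : nat) (G H : graph) (f : G -> H) : Prop :=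
  forall x y, dist (f x) (f y) <= K * dist x y + K.

(** One positive integer bounds the multiplicative and the additive constant
    of both maps, which spares real arithmetic in the game. *)
Definition nat_retraction (K : nat) (G H : graph) (f : H -> G) (g : G -> H)
    : Prop :=
  [/\ 0 < K, nat_lipschitz K f, nat_lipschitz K g
    & forall x, dist (g (f x)) x <= K].

Lemma coarse_lipschitz_nat (R : realType) (G H : graph) (C D : R) (K : nat)
    (f : G -> H) :
  (C <= K%:R)%R -> (D <= K%:R)%R ->
  coarse_lipschitz (@gdist R G) (@gdist R H) C D f -> nat_lipschitz K f.
Proof.
move=> CK DK lipf x y; rewrite -(ler_nat R) natrD natrM.
by apply: le_trans (lipf x y) _; rewrite lerD ?ler_wpM2r /gdist ?ler0n.
Qed.

Lemma quasi_retraction_nat (R : realType) (G H : graph)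
    (f : H -> G) (g : G -> H) :
  quasi_retraction (@gdist R H) (@gdist R G) f g ->
  exists K, nat_retraction K f g.
Proof.
move=> [C [D [C1 D0 lipf lipg gf]]].
have C0 : (0 <= C)%R by apply: le_trans C1.
have [CK DK] : (C <= (Num.bound C + Num.bound D)%:R)%R
    /\ (D <= (Num.bound C + Num.bound D)%:R)%R.
  have := archi_boundP C0; have := archi_boundP D0 => /ltW hD /ltW hC.
  by split; rewrite natrD; [rewrite ler_wpDr | rewrite ler_wpDl].
exists (Num.bound C + Num.bound D); split.
- by rewrite -(ltr_nat R); apply: lt_le_trans (le_trans C1 CK).
- exact: coarse_lipschitz_nat lipf.
- exact: coarse_lipschitz_nat lipg.
- by move=> x; rewrite -(ler_nat R); apply: le_trans (gf x) DK.
Qed.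

(** * The shadow of a robber move *)

(** Points of [G] within [d] of the shadow [f x] pull back, up to this bound, to
    points of [H] near [x]. *)
Definition pullback_radius (K d : nat) : nat := K + (K * d + K).

Lemma near_shadow (G H : graph) (K d : nat) (f : H -> G) (g : G -> H)
    (x : H) (y : G) :
  connected H -> nat_retraction K f g -> dist (f x) y <= d ->
  dist x (g y) <= pullback_radius K d.
Proof.
move=> conH [_ _ lipg gf] xy.
apply: leq_trans (dist_triangle x (g (f x)) (g y) conH) _.
rewrite leq_add //; first by rewrite dist_sym.
by apply: leq_trans (lipg _ _) _; rewrite leq_add2r leq_mul2l xy orbT.
Qed.

Lemma leq_pullback_radius (K d e : nat) :
  d <= e -> pullback_radius K d <= pullback_radius K e.
Proof. by move=> de; rewrite leq_add2l leq_add2r leq_mul2l de orbT. Qed.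

Lemma robber_move_trans (G : graph) (n rho psi1 psi2 : nat) (c : cops G n)
    (x y z : G) :
  robber_move rho psi1 c x y -> robber_move rho psi2 c y z ->
  robber_move rho (psi1 + psi2) c x z.
Proof.
move=> [p [xp lp sp /= /andP[cx cp]]] [q [yq lq sq /= /andP[_ cq]]].
exists (p ++ q); split.
- by rewrite cat_path xp lp.
- by rewrite last_cat lp.
- by rewrite size_cat leq_add.
- by rewrite /= cx all_cat cp.
Qed.

(** Replaces induction on the path in proofs about all its vertices. *)
Lemma all_last_prefix (T : Type) (P : pred T) (x : T) (p : seq T) :
  (forall q s, p = q ++ s -> P (last x q)) -> all P (x :: p).
Proof.
elim: p x => [|y p IHp] x Pp; rewrite [all _ _]/=.
  by rewrite andbT; exact: (Pp [::] [::]).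
apply/andP; split; first exact: (Pp [::] (y :: p)).
by apply: IHp => q s pE; apply: (Pp (y :: q) s); rewrite pE.
Qed.

(** Every vertex of a geodesic of length at most [L] is within [L] of its
    starting point, so it is enough that this point be [L] farther away from
    the cops than the path has to be. *)
Lemma robber_move_geodesic (G : graph) (n rho L : nat) (c : cops G n) (x y : G) :
  connected G -> dist x y <= L -> (forall i, rho + L < dist x (c i)) ->
  robber_move rho L c x y.
Proof.
move=> conG xy far; have [p [xp lp sp]] := geodesic_exists x y conG.
exists p; split=> //; first by rewrite sp.
apply: all_last_prefix => q s pE; apply/forallP => i.
move: xp; rewrite pE cat_path => /andP[xq _].
have qL : size q <= L.
  by rewrite -sp pE size_cat in xy; apply: leq_trans xy; exact: leq_addr.
rewrite -(ltn_add2r L); apply: leq_trans (far i) _.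
apply: leq_trans (dist_triangle x (last x q) (c i) conG) _.
by rewrite addnC leq_add2l; apply: leq_trans (dist_le_size xq) qL.
Qed.

(** The image of an edge under [f] spans a distance of at most [K + K], so a
    path of length [psi] is shadowed by one of length [psi * (K + K)]; the same
    [K + K] is added to the reach to keep the cops away from the geodesics
    that replace the images of the edges. *)
Lemma robber_move_shadow (G H : graph) (K n rho psi : nat)
    (f : H -> G) (g : G -> H) (c : cops G n) (x y : H) :
  connected G -> connected H -> nat_retraction K f g ->
  robber_move (pullback_radius K (rho + (K + K))) psi (g \o c) x y ->
  robber_move rho (psi * (K + K)) c (f x) (f y).
Proof.
move=> conG conH fg; have [_ lipf _ _] := fg.
move=> [p [xp <- sp]] {y}.
have far z : [forall i, pullback_radius K (rho + (K + K)) < dist z (g (c i))] ->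
    forall i, rho + (K + K) < dist (f z) (c i).
  move=> /forallP farz i; rewrite ltnNge; apply/negP => fzc.
  by have := farz i; rewrite ltnNge (near_shadow conH fg fzc).
elim: p psi x xp sp => [|z p IHp] psi x.
  move=> _ _ /= /andP[/far farx _]; exists [::]; split=> //=.
  rewrite andbT; apply/forallP => i; apply: leq_ltn_trans (farx i).
  exact: leq_addr.
case: psi => // psi /= /andP[xz zp] sp /andP[/far farx farp].
rewrite mulSn; apply: robber_move_trans (IHp psi z zp sp farp).
apply: robber_move_geodesic => //.
apply: leq_trans (lipf x z) _; rewrite leq_add2r.
by rewrite -{2}(muln1 K) leq_mul2l dist_adj ?orbT.
Qed.

(** * The cops' strategy obtained from the shadow game *)

(** The history of the shadow game.  The shadow cops are not visible in the
    real game, and are reconstructed from the moves of the robber. *)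
Definition shadow_history (G H : graph) (n : nat) (f : H -> G)
    (S : cop_strategy G n) (h : seq (cops H n * H)) : seq (cops G n * G) :=
  foldl (fun s cr => rcons s (S s, f cr.2)) [::] h.

(** A legal strategy has to respect the speed bound at every history, even at
    those that it never produces; there the cops who cannot reach their
    prescribed positions stay where they are. *)
Definition shadow_strategy (G H : graph) (n sigma : nat) (f : H -> G)
    (g : G -> H) (S : cop_strategy G n) : cop_strategy H n :=
  fun h =>
    let target := g \o S (shadow_history f S h) in
    let current := last target (map fst h) in
    fun i => if dist (current i) (target i) <= sigma
             then target i else current i.

Lemma shadow_history_rcons (G H : graph) (n : nat) (f : H -> G)
    (S : cop_strategy G n) h (c : cops H n) (r : H) :
  shadow_history f S (rcons h (c, r)) =
  rcons (shadow_history f S h) (S (shadow_history f S h), f r).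
Proof. by rewrite /shadow_history foldl_rcons. Qed.

Lemma shadow_strategy_legal (G H : graph) (n sigma : nat) (f : H -> G)
    (g : G -> H) (S : cop_strategy G n) :
  legal_strategy sigma (shadow_strategy sigma f g S).
Proof.
move=> h c r i; rewrite /shadow_strategy map_rcons last_rcons /=.
by case: ifP => // _; rewrite dist_refl.
Qed.

(** Recomputing the shadow history from ever longer real histories yields one
    consistent play, to which the winning property of [S] applies. *)
Lemma shadow_follows (G H : graph) (n : nat) (f : H -> G)
    (S : cop_strategy G n) (c : nat -> cops H n) (r : nat -> H) :
  follows S (fun k => S (shadow_history f S (mkseq (fun j => (c j, r j)) k)))
    (f \o r).
Proof.
move=> k; congr S; elim: k => // k IHk.
by rewrite !mkseqS shadow_history_rcons -IHk.
Qed.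

(** Along its own plays the strategy never resorts to its fallback, since the
    maps [g] and [S] move the cops slowly enough. *)
Lemma shadow_strategy_play (G H : graph) (K n sigma : nat) (f : H -> G)
    (g : G -> H) (S : cop_strategy G n) (c : nat -> cops H n) (r : nat -> H) :
  nat_lipschitz K g -> legal_strategy sigma S ->
  follows (shadow_strategy (K * sigma + K) f g S) c r ->
  forall k, c k = g \o S (shadow_history f S (mkseq (fun j => (c j, r j)) k)).
Proof.
move=> lipg legS foll; elim=> [|k IHk]; rewrite foll /shadow_strategy.
  by apply/funext => i /=; case: ifP.
apply/funext => i; rewrite mkseqS map_rcons last_rcons shadow_history_rcons.
rewrite IHk /= ifT //; apply: leq_trans (lipg _ _) _.
by rewrite leq_add2r leq_mul2l legS orbT.
Qed.

(** * Transfer of winning strategies *)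

(** [sigma] alone determines the new speed and [rho] alone the new reach, while
    [psi] and [R] are those wanted on [H]: hence it serves weak and strong cop
    numbers alike. *)
Lemma CopWin_retract (G H : graph) (K n sigma rho psi R : nat)
    (f : H -> G) (g : G -> H) :
  connected G -> connected H -> nat_retraction K f g ->
  CopWin G n sigma rho (psi * (K + K)) (K * R + K) ->
  CopWin H n (K * sigma + K) (pullback_radius K (rho + (K + K))) psi R.
Proof.
move=> conG conH fg win v; have [_ lipf lipg _] := fg.
have [S [legS winS]] := win (f v).
exists (shadow_strategy (K * sigma + K) f g S).
split; first exact: shadow_strategy_legal.
move=> c r foll play.
have cE := shadow_strategy_play lipg legS foll.
(* The rules bind the robber only while he is free, so the shadow is known to
   move legally only if the real robber is never captured. *)
have [|free] :=
    pselect (exists k, captured (pullback_radius K (rho + (K + K)))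
                         (c k.+1) (r k)).
  by left.
have follS := shadow_follows f S c r.
move: cE follS; set cG := (fun k => S _) => cE follS.
have playS : robber_plays_legally rho (psi * (K + K)) cG (f \o r).
  move=> k _; apply: (robber_move_shadow conG conH fg).
  have -> : g \o cG k.+1 = c k.+1 by rewrite [RHS]cE.
  by apply: play; apply/negP => cap; apply: free; exists k.
have [[k /existsP[i near]]|[N [N0 far]]] := winS _ _ follS playS.
  left; exists k; apply/existsP; exists i; rewrite cE.
  apply: leq_trans (near_shadow conH fg near) _.
  by apply: leq_pullback_radius; exact: leq_addr.
right; exists N; split=> // k /far; rewrite !ltnNge; apply: contra => near.
by apply: leq_trans (lipf _ _) _; rewrite leq_add2r leq_mul2l near orbT.
Qed.

Lemma weak_cop_win_retract (G H : graph) (K n : nat) (f : H -> G) (g : G -> H) :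
  connected G -> connected H -> nat_retraction K f g ->
  weak_cop_win G n -> weak_cop_win H n.
Proof.
move=> conG conH fg [sigma [sigma0 [rho win]]]; have [K0 _ _ _] := fg.
exists (K * sigma + K); split; first by rewrite addn_gt0 K0 orbT.
exists (pullback_radius K (rho + (K + K))) => psi R psi0 R0.
apply: (CopWin_retract conG conH fg); apply: win.
  by rewrite muln_gt0 psi0 addn_gt0 K0.
by rewrite addn_gt0 K0 orbT.
Qed.

Lemma strong_cop_win_retract (G H : graph) (K n : nat) (f : H -> G)
    (g : G -> H) :
  connected G -> connected H -> nat_retraction K f g ->
  strong_cop_win G n -> strong_cop_win H n.
Proof.
move=> conG conH fg [sigma [sigma0 win]]; have [K0 _ _ _] := fg.
exists (K * sigma + K); split; first by rewrite addn_gt0 K0 orbT.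
move=> psi psi0; have [|rho winrho] := win (psi * (K + K)).
  by rewrite muln_gt0 psi0 addn_gt0 K0.
exists (pullback_radius K (rho + (K + K))) => R R0.
apply: (CopWin_retract conG conH fg); apply: winrho.
by rewrite addn_gt0 K0 orbT.
Qed.

Theorem corollary7 (R : realType) (G D : graph)
    (hG : connected G) (hD : connected D) (hGD : quasi_isometric R G D) :
  wCop D = wCop G /\ sCop D = sCop G.
Proof.
have [f [g [/quasi_retraction_nat[K fg] /quasi_retraction_nat[L gf]]]] := hGD.
split; congr least_positive; apply/funext => n; apply/propext; split.
- exact: weak_cop_win_retract gf.
- exact: weak_cop_win_retract fg.
- exact: strong_cop_win_retract gf.
- exact: strong_cop_win_retract fg.
Qed.
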